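(* Let $k\in\mathbb{N}_0$ and let $\mathcal{M}^{2,\pm}_{j}=\mathcal{M}_j(\mathbb{R}^2,S^{\pm})$ for each $j=0,\ldots,k$. Then $$\mathcal{M}^{2,+}_{j}=\mathrm{span}_{\mathbb{C}}\{(\overline{z}^{\,j},0)\},\qquad \mathcal{M}^{2,-}_{j}=\mathrm{span}_{\mathbb{C}}\{(0,z^j)\},$$ $$\mathcal{P}_k(\mathbb{R}^2,S^{+})=\bigoplus_{j=0}^k z^j\mathcal{M}^{2,+}_{k-j}\quad\text{and}\quad \mathcal{P}_k(\mathbb{R}^2,S^{-})=\bigoplus_{j=0}^k \overline{z}^{\,j}\mathcal{M}^{2,-}_{k-j}.$$ In addition, for each $j=0,\ldots,k$, the $\mathfrak{so}(2)$-modules $z^j\mathcal{M}^{2,+}_{k-j}$ and $\overline{z}^{\,j}\mathcal{M}^{2,-}_{k-j}$ are both irreducible with the highest weights $k+\frac12-2j$ and $-k-\frac12+2j$, respectively.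
   Context: $\mathbb{C}_2$ is the complex Clifford algebra generated by $e_1,e_2$ with $e_1^2=e_2^2=-1$, $e_1e_2=-e_2e_1$; $e_{12}=e_1e_2$. Put $I_1=\frac12(1-ie_{12})$ and $w_1I_1=\frac12(e_1+ie_2)$ (where $w_1=\frac12(e_1+ie_2)$). The spinor space is $S=\mathrm{span}_{\mathbb{C}}\{I_1,w_1I_1\}$, with $S^{+}=\mathrm{span}_{\mathbb{C}}\{I_1\}$ and $S^{-}=\mathrm{span}_{\mathbb{C}}\{w_1I_1\}$. An element $s=s^{+}I_1+s^{-}w_1I_1$ ($s^\pm\in\mathbb{C}$) is written $s=(s^+,s^-)$, and correspondingly an $S$-valued polynomial $P$ is written $(P^+,P^-)$ with complex valued polynomials $P^\pm$ in $z=x_1+ix_2$ and $\overline{z}=x_1-ix_2$, where $(x_1,x_2)\in\mathbb{R}^2$. For a subspace $T\subset S$, $\mathcal{P}_k(\mathbb{R}^2,T)$ denotes the space of $T$-valued $k$-homogeneous polynomials on $\mathbb{R}^2$, and, for $T=S^\pm$, $\mathcal{M}_k(\mathbb{R}^2,T)=\{P\in\mathcal{P}_k(\mathbb{R}^2,T):\partial P=0\}$ with the Dirac operator $\partial=e_1\frac{\partial}{\partial x_1}+e_2\frac{\partial}{\partial x_2}$ acting by left Clifford multiplication. The Lie algebra $\mathfrak{so}(2)=\mathrm{span}\{e_{12}\}$ acts on $\mathcal{P}_k(\mathbb{R}^2,S)$ by letting $e_{12}/2$ act as $L_{12}=\frac{e_{12}}{2}+x_2\frac{\partial}{\partial x_1}-x_1\frac{\partial}{\partial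 x_2}$. Weights are the eigenvalues of $H=-iL_{12}$; the highest weight of a one-dimensional module is the eigenvalue of $H$ on it. *)

(* Defs.v *)
From HB Require Import structures.
From mathcomp Require Import all_boot all_order all_algebra.
From mathcomp Require Import complex boolp classical_sets reals mpoly ring.

Set Implicit Arguments.
Unset Strict Implicit.
Unset Printing Implicit Defensive.

Import Order.TTheory GRing.Theory Num.Theory.

Local Open Scope classical_set_scope.
Local Open Scope ring_scope.

(** The Clifford algebra on two generators with e1^2 = e2^2 = -1 over a
    commutative ring K: [Cl2 a b c d] is a + b e1 + c e2 + d e12. *)
Record cl2 (K : Type) := Cl2 { cl0 : K; cl1 : K; cl2_ : K; cl12 : K }.

Definition cl2_tuple (K : Type) (u : cl2 K) : K * K * K * K :=
  (cl0 u, cl1 u, cl2_ u, cl12 u).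
Definition tuple_cl2 (K : Type) (t : K * K * K * K) : cl2 K :=
  let: (a, b, c, d) := t in Cl2 a b c d.
Lemma cl2_tupleK (K : Type) : cancel (@cl2_tuple K) (@tuple_cl2 K).
Proof. by case. Qed.

HB.instance Definition _ (K : choiceType) :=
  Choice.copy (cl2 K) (can_type (@cl2_tupleK K)).

Definition cl2_zero (K : comNzRingType) : cl2 K := Cl2 0 0 0 0.
Definition cl2_one (K : comNzRingType) : cl2 K := Cl2 1 0 0 0.
Definition cl2_opp (K : comNzRingType) (u : cl2 K) : cl2 K :=
  Cl2 (- cl0 u) (- cl1 u) (- cl2_ u) (- cl12 u).
Definition cl2_add (K : comNzRingType) (u v : cl2 K) : cl2 K :=
  Cl2 (cl0 u + cl0 v) (cl1 u + cl1 v) (cl2_ u + cl2_ v) (cl12 u + cl12 v).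
Definition cl2_scale (K : comNzRingType) (a : K) (u : cl2 K) : cl2 K :=
  Cl2 (a * cl0 u) (a * cl1 u) (a * cl2_ u) (a * cl12 u).
(** Obtained by expanding with e12 = e1 e2, e2 e1 = - e12, e1 e12 = - e2,
    e12 e1 = e2, e2 e12 = e1, e12 e2 = - e1, e12^2 = -1. *)
Definition cl2_mul (K : comNzRingType) (u v : cl2 K) : cl2 K :=
  Cl2 (cl0 u * cl0 v - cl1 u * cl1 v - cl2_ u * cl2_ v - cl12 u * cl12 v)
      (cl0 u * cl1 v + cl1 u * cl0 v + cl2_ u * cl12 v - cl12 u * cl2_ v)
      (cl0 u * cl2_ v + cl2_ u * cl0 v - cl1 u * cl12 v + cl12 u * cl1 v)
      (cl0 u * cl12 v + cl12 u * cl0 v + cl1 u * cl2_ v - cl2_ u * cl1 v).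

Fact cl2_addA (K : comNzRingType) : associative (@cl2_add K).
Proof. by move=> [? ? ? ?] [? ? ? ?] [? ? ? ?]; congr Cl2; rewrite /= addrA. Qed.
Fact cl2_addC (K : comNzRingType) : commutative (@cl2_add K).
Proof. by move=> [? ? ? ?] [? ? ? ?]; congr Cl2; rewrite /= addrC. Qed.
Fact cl2_add0 (K : comNzRingType) : left_id (@cl2_zero K) (@cl2_add K).
Proof. by move=> [? ? ? ?]; congr Cl2; rewrite /= add0r. Qed.
Fact cl2_addN (K : comNzRingType) :
  left_inverse (@cl2_zero K) (@cl2_opp K) (@cl2_add K).
Proof. by move=> [? ? ? ?]; congr Cl2; rewrite /= addNr. Qed.

HB.instance Definition _ (K : comNzRingType) :=
  GRing.isZmodule.Build (cl2 K)
    (@cl2_addA K) (@cl2_addC K) (@cl2_add0 K) (@cl2_addN K).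

Fact cl2_mulA (K : comNzRingType) : associative (@cl2_mul K).
Proof. by move=> [? ? ? ?] [? ? ? ?] [? ? ? ?]; congr Cl2 => /=; ring. Qed.
Fact cl2_mul1u (K : comNzRingType) : left_id (@cl2_one K) (@cl2_mul K).
Proof. by move=> [? ? ? ?]; congr Cl2 => /=; ring. Qed.
Fact cl2_mulu1 (K : comNzRingType) : right_id (@cl2_one K) (@cl2_mul K).
Proof. by move=> [? ? ? ?]; congr Cl2 => /=; ring. Qed.
Fact cl2_mulDl (K : comNzRingType) : left_distributive (@cl2_mul K) +%R.
Proof. by move=> [? ? ? ?] [? ? ? ?] [? ? ? ?]; congr Cl2 => /=; ring. Qed.
Fact cl2_mulDr (K : comNzRingType) : right_distributive (@cl2_mul K) +%R.
Proof. by move=> [? ? ? ?] [? ? ? ?] [? ? ? ?]; congr Cl2 => /=; ring. Qed.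
Fact cl2_one_neq0 (K : comNzRingType) : @cl2_one K != 0.
Proof. by apply/eqP => -[] /eqP; rewrite oner_eq0. Qed.

HB.instance Definition _ (K : comNzRingType) :=
  GRing.Zmodule_isNzRing.Build (cl2 K)
    (@cl2_mulA K) (@cl2_mul1u K) (@cl2_mulu1 K)
    (@cl2_mulDl K) (@cl2_mulDr K) (@cl2_one_neq0 K).

Fact cl2_scaleA (K : comNzRingType) (a b : K) (u : cl2 K) :
  cl2_scale a (cl2_scale b u) = cl2_scale (a * b) u.
Proof. by congr Cl2; rewrite /= mulrA. Qed.
Fact cl2_scale1 (K : comNzRingType) : left_id 1 (@cl2_scale K).
Proof. by move=> [? ? ? ?]; congr Cl2; rewrite /= mul1r. Qed.
Fact cl2_scaleDr (K : comNzRingType) : right_distributive (@cl2_scale K) +%R.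
Proof. by move=> a u v; congr Cl2; rewrite /= mulrDr. Qed.
Fact cl2_scaleDl (K : comNzRingType) (u : cl2 K) :
  {morph (@cl2_scale K)^~ u : a b / a + b}.
Proof. by move=> a b; congr Cl2; rewrite /= mulrDl. Qed.

HB.instance Definition _ (K : comNzRingType) :=
  GRing.Zmodule_isLmodule.Build K (cl2 K)
    (@cl2_scaleA K) (@cl2_scale1 K) (@cl2_scaleDr K) (@cl2_scaleDl K).

Fact cl2_scaleAl (K : comNzRingType) (a : K) (u v : cl2 K) :
  a *: (u * v) = (a *: u) * v.
Proof. by congr Cl2 => /=; ring. Qed.
Fact cl2_scaleAr (K : comNzRingType) (a : K) (u v : cl2 K) :
  a *: (u * v) = u * (a *: v).
Proof. by congr Cl2 => /=; ring. Qed.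

HB.instance Definition _ (K : comNzRingType) :=
  GRing.Lmodule_isLalgebra.Build K (cl2 K) (@cl2_scaleAl K).
HB.instance Definition _ (K : comNzRingType) :=
  GRing.Lalgebra_isAlgebra.Build K (cl2 K) (@cl2_scaleAr K).

Definition e1 (K : comNzRingType) : cl2 K := Cl2 0 1 0 0.
Definition e2 (K : comNzRingType) : cl2 K := Cl2 0 0 1 0.
Definition e12 (K : comNzRingType) : cl2 K := e1 K * e2 K.
Arguments e1 {K}.
Arguments e2 {K}.
Arguments e12 {K}.

Lemma e1_sq (K : comNzRingType) : e1 * e1 = -1 :> cl2 K.
Proof. by congr Cl2 => /=; ring. Qed.
Lemma e2_sq (K : comNzRingType) : e2 * e2 = -1 :> cl2 K.
Proof. by congr Cl2 => /=; ring. Qed.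
Lemma e1e2_anticomm (K : comNzRingType) : e1 * e2 = - (e2 * e1) :> cl2 K.
Proof. by congr Cl2 => /=; ring. Qed.
Lemma cl2_basis (K : comNzRingType) (a b c d : K) :
  Cl2 a b c d = a *: 1 + b *: e1 + c *: e2 + d *: e12.
Proof. by congr Cl2 => /=; ring. Qed.

(** Cl2-valued polynomials on R^2, as polynomials in x1, x2 with coefficients in
    the complexified algebra; the coefficients commute with the variables.
    The library scaling of [clpoly R] is left multiplication by an element of
    [cl2 R[i]]; complex scalars c act through [c%:A]. *)
Notation clpoly R := {mpoly (cl2 R[i])[2]}.

Definition x1 (K : nzRingType) : {mpoly K[2]} := 'X_ord0.
Definition x2 (K : nzRingType) : {mpoly K[2]} := 'X_ord_max.
Arguments x1 {K}.
Arguments x2 {K}.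
Definition d1 (K : nzRingType) (P : {mpoly K[2]}) : {mpoly K[2]} :=
  P^`M(ord0).
Definition d2 (K : nzRingType) (P : {mpoly K[2]}) : {mpoly K[2]} :=
  P^`M(ord_max).

Definition z (R : realType) : {mpoly R[i][2]} := x1 + 'i *: x2.
Definition zbar (R : realType) : {mpoly R[i][2]} := x1 - 'i *: x2.

Definition scalar_poly (R : realType) (p : {mpoly R[i][2]}) : clpoly R :=
  map_mpoly (in_alg (cl2 R[i])) p.

Definition I1 (R : realType) : cl2 R[i] := 2^-1 *: (1 - 'i *: e12).
Definition w1 (R : realType) : cl2 R[i] := 2^-1 *: (e1 + 'i *: e2).

Definition Splus (R : realType) : set (cl2 R[i]) :=
  [set a *: I1 R | a in [set: R[i]]].
Definition Sminus (R : realType) : set (cl2 R[i]) :=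
  [set a *: (w1 R * I1 R) | a in [set: R[i]]].
Arguments Splus R : clear implicits.
Arguments Sminus R : clear implicits.

(** The S-valued polynomial (P^+, P^-). *)
Definition spinor_poly (R : realType) (Pp Pm : {mpoly R[i][2]}) : clpoly R :=
  scalar_poly Pp * (I1 R)%:MP + scalar_poly Pm * (w1 R * I1 R)%:MP.

(** As R is infinite, the polynomial function of P is T-valued exactly when all
    the coefficients of P lie in the subspace T. *)
Definition homog_poly (R : realType) (k : nat) (T : set (cl2 R[i])) :
    set (clpoly R) :=
  [set P | P \is k.-homog /\ forall m, T P@_m].

Definition dirac (R : realType) (P : clpoly R) : clpoly R :=
  e1%:MP * d1 P + e2%:MP * d2 P.

Definition monogenic (R : realType) (k : nat) (T : set (cl2 R[i])) :
    set (clpoly R) :=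
  [set P | homog_poly k T P /\ dirac P = 0].

Definition pmul (R : realType) (q : {mpoly R[i][2]}) (W : set (clpoly R)) :
    set (clpoly R) :=
  [set scalar_poly q * P | P in W].

Definition cspan (R : realType) (P : clpoly R) : set (clpoly R) :=
  [set c%:A *: P | c in [set: R[i]]].

Definition subspace (R : realType) (W : set (clpoly R)) : Prop :=
  W 0 /\ forall (c : R[i]) P Q, W P -> W Q -> W (c%:A *: P + Q).

Definition direct_sum (R : realType) (n : nat) (U : 'I_n -> set (clpoly R))
    (W : set (clpoly R)) : Prop :=
  [/\ forall i, subspace (U i),
      W = [set \sum_i f i | f in [set f | forall i, U i (f i)]] &
      forall f : 'I_n -> clpoly R,
        (forall i, U i (f i)) -> \sum_i f i = 0 -> forall i, f i = 0].

Definition L12 (R : realType) (P : clpoly R) : clpoly R :=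
  (2^-1 *: e12)%:MP * P + x2 * d1 P - x1 * d2 P.

Definition H (R : realType) (P : clpoly R) : clpoly R :=
  (- 'i)%:A *: L12 P.

Definition so2 (R : realType) : set (cl2 R[i]) :=
  [set t%:C%C *: e12 | t in [set: R]].
Arguments so2 R : clear implicits.

(** The action of X = t e12 is 2 t L12; here t is read off as the
    e12-coordinate of X. *)
Definition so2_act (R : realType) (X : cl2 R[i]) (P : clpoly R) : clpoly R :=
  (2 * cl12 X)%:A *: L12 P.

Lemma so2_act_half_e12 (R : realType) (P : clpoly R) :
  so2_act (2^-1 *: e12) P = L12 P.
Proof.
rewrite /so2_act (_ : cl12 _ = 2^-1); last by rewrite /=; ring.
by rewrite divff ?pnatr_eq0// !scale1r.
Qed.

Definition so2_submodule (R : realType) (W : set (clpoly R)) : Prop :=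
  subspace W /\ forall X P, so2 R X -> W P -> W (so2_act X P).

Definition so2_irreducible (R : realType) (W : set (clpoly R)) : Prop :=
  [/\ so2_submodule W, exists2 P, W P & P <> 0 &
      forall U, so2_submodule U -> U `<=` W -> U = [set 0] \/ U = W].

(** Only for one-dimensional modules, where it is the eigenvalue of H. *)
Definition has_highest_weight (R : realType) (W : set (clpoly R))
    (lambda : R[i]) : Prop :=
  (exists2 P, P <> 0 & W = cspan P) /\
  forall P, W P -> H P = lambda%:A *: P.

(* Main.v *)
Require Import Defs.
From mathcomp Require Import all_boot all_order all_algebra.
From mathcomp Require Import complex boolp classical_sets reals mpoly ring.

Import Order.TTheory GRing.Theory Num.Theory.
Local Open Scope classical_set_scope.
Local Open Scope ring_scope.

(** Both halves are one statement about a pair (e, s) with e^2 = -1 and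
    e12 s = e s, where s spans the spinor line: s = I1 with e = i gives S^+, and
    s = w1 I1 with e = -i gives S^-.  Put u = x1 + e x2 and v = x1 - e x2, so
    that (u, v) is (z, zbar) in the first case and (zbar, z) in the second.

    Since e2 s = - e e1 s, the Dirac operator sends p s to
    (d1 p - e d2 p) e1 s, and L12 sends it to (e/2 p + x2 d1 p - x1 d2 p) s
    ([dirac_spin], [L12_spin]).  Everything about the spinor-valued polynomials
    is thereby read off from the complex polynomial p.

    As u and v are a linear change of variables from x1 and x2, the products
    u^j v^(k-j) form a basis of the k-homogeneous polynomials
    ([homog_isomonP], [isomon_free]).  Two derivations are diagonal in this
    basis.  The operator u (d1 - e d2) has u and v as eigenvectors with
    eigenvalues 2 and 0, hence u^j v^(k-j) has eigenvalue 2 j, and the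
    monogenic polynomials are the multiples of v^k
    ([homog_antiholomorphicP]).  The rotation field x2 d1 - x1 d2 has eigenvalues
    -e and e on u and v, hence e (k - 2 j) on u^j v^(k-j), so that
    H = -i L12 acts on u^j v^(k-j) s by -i e (k + 1/2 - 2 j)
    ([L12_isomon]).  The summand with index j is the line through
    u^j v^(k-j) s, so the basis gives the direct sum, and a line stable under L12
    is irreducible ([line_irreducible]). *)

(** * Homogeneous polynomials in isotropic coordinates *)

(** The form is isotropic when e^2 = -1; it is z for e = i and zbar for e = -i. *)
Definition isoform (K : nzRingType) (e : K) : {mpoly K[2]} := x1 + e *: x2.
Arguments isoform {K}.

Definition isomon (K : nzRingType) (e : K) (k j : nat) : {mpoly K[2]} :=
  isoform e ^+ j * isoform (- e) ^+ (k - j).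
Arguments isomon {K}.

Section ScalarPolynomials.
Variables (K : numFieldType) (e : K).
Hypothesis e_sq : e * e = -1.

Local Notation u := (isoform e).
Local Notation v := (isoform (- e)).

(** A derivation acts on powers and products of eigenvectors by adding
    eigenvalues; this computes both the monogenic polynomials and the weights. *)
Lemma leibniz_eigen_monomial (D : {mpoly K[2]} -> {mpoly K[2]}) (a b : K)
    (p q : {mpoly K[2]}) (m n : nat) :
    (forall f g, D (f * g) = D f * g + f * D g) ->
    D p = a *: p -> D q = b *: q ->
  D (p ^+ m * q ^+ n) = (a * m%:R + b * n%:R) *: (p ^+ m * q ^+ n).
Proof.
move=> Dleib Dp Dq.
have D1 : D 1 = 0.
  by have /eqP := Dleib 1 1; rewrite !mulr1 mul1r -subr_eq subrr eq_sym => /eqP.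
have Dexp f c l : D f = c *: f -> D (f ^+ l) = (c * l%:R) *: f ^+ l.
  move=> Df; elim: l => [|l IH]; first by rewrite expr0 mulr0 scale0r.
  by rewrite exprS Dleib Df IH -scalerAr -scalerAl -scalerDl mulrS mulrDr mulr1.
by rewrite Dleib (Dexp _ _ _ Dp) (Dexp _ _ _ Dq) -scalerAr -scalerAl -scalerDl.
Qed.

Lemma d1_isoform (c : K) : d1 (isoform c) = 1.
Proof.
rewrite /d1 /isoform mderivD mderivZ !mderivX !mnm1E /= scale0r scaler0 addr0.
by rewrite -[X in (X - _)%MM]addm0 addmC addmK scale1r mpolyX0.
Qed.

Lemma d2_isoform (c : K) : d2 (isoform c) = c%:MP.
Proof.
rewrite /d2 /isoform mderivD mderivZ !mderivX !mnm1E /= scale0r add0r.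
by rewrite -[X in (X - _)%MM]addm0 addmC addmK scale1r mpolyX0 -alg_mpolyC.
Qed.

(** With d1 - e d2 twice the derivative along u, this is twice the Euler field
    u d/du.  Multiplying by u keeps the basis diagonal instead of shifting it. *)
Definition euler_u (p : {mpoly K[2]}) := u * (d1 p - e *: d2 p).
Definition rotation (p : {mpoly K[2]}) := x2 * d1 p - x1 * d2 p.

Lemma euler_u_isomon (k j : nat) :
  euler_u (isomon e k j) = (2 * j%:R) *: isomon e k j.
Proof.
rewrite -[2 * _]addr0 -[X in _ + X](mul0r (k - j)%:R).
apply: leibniz_eigen_monomial => [f g||].
- rewrite /euler_u /d1 /d2 !mderivM scalerDr -!mul_mpolyC; ring.
- rewrite /euler_u d1_isoform d2_isoform -!mul_mpolyC -mpolyCM e_sq.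
  by rewrite mpolyCN mpolyCMn mpolyC1; ring.
- rewrite /euler_u d1_isoform d2_isoform -mul_mpolyC -mpolyCM mulrN e_sq.
  by rewrite opprK mpolyC1 subrr mulr0 scale0r.
Qed.

Lemma rotation_isomon (k j : nat) : (j <= k)%N ->
  rotation (isomon e k j) = (e * (k%:R - 2 * j%:R)) *: isomon e k j.
Proof.
move=> lejk.
have -> : e * (k%:R - 2 * j%:R) = - e * j%:R + e * (k - j)%:R.
  by rewrite natrB//; ring.
have rotationE (c : K) : c * c = -1 -> rotation (isoform c) = - c *: isoform c.
  move=> cc; rewrite /rotation d1_isoform d2_isoform /isoform.
  rewrite -!mul_mpolyC mpolyCN.
  have: (c%:MP * c%:MP : {mpoly K[2]}) = -1 by rewrite -mpolyCM cc mpolyCN.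
  move: (c%:MP) => c' cc'.
  have -> : - c' * (x1 + c' * x2) = - c' * x1 - (c' * c') * x2 by ring.
  by rewrite cc'; ring.
apply: leibniz_eigen_monomial => [f g||].
- rewrite /rotation /d1 /d2 !mderivM; ring.
- exact: rotationE.
- by rewrite rotationE ?opprK// mulrNN.
Qed.

Lemma mon2E (a b : nat) : (x1 ^+ a * x2 ^+ b : {mpoly K[2]}) =
  'X_[U_(ord0) *+ a + U_(ord_max) *+ b].
Proof. by rewrite mpolyXD -!mpolyXn. Qed.

Let e_neq0 : e != 0.
Proof.
apply/eqP => e0; move/eqP: e_sq.
by rewrite e0 mul0r eq_sym oppr_eq0 oner_eq0.
Qed.

(** The substitution sending u to x1 and v to x2, by which facts about monomials
    are carried over to the products u^j v^(k-j). *)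
Let to_std : 2.-tuple {mpoly K[2]} :=
  [tuple 2^-1 *: (x1 + x2); (2 * e)^-1 *: (x1 - x2)].

Lemma isomon_to_std (k j : nat) :
  isomon e k j \mPo to_std = x1 ^+ j * x2 ^+ (k - j).
Proof.
have E (c : K) : isoform c \mPo to_std =
    2^-1 *: (x1 + x2) + (c * (2 * e)^-1) *: (x1 - x2).
  by rewrite comp_mpolyD comp_mpolyZ !comp_mpolyXU /= scalerA.
rewrite /isomon rmorphM !rmorphXn /= !E; congr (_ ^+ _ * _ ^+ _).
- rewrite invfM mulrCA divff// mulr1 -scalerDr addrACA subrr addr0 -mulr2n.
  by rewrite -scaler_nat scalerA mulVf ?scale1r// pnatr_eq0.
- rewrite mulNr invfM mulrCA divff// mulr1 scaleNr -scalerBr opprB.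
  rewrite [x1 + x2]addrC addrACA subrr addr0 -mulr2n.
  by rewrite -scaler_nat scalerA mulVf ?scale1r// pnatr_eq0.
Qed.

Lemma isomon_free (k : nat) (c : 'I_k.+1 -> K) :
  \sum_j c j *: isomon e k j = 0 -> forall j, c j = 0.
Proof.
move=> /(congr1 (comp_mpoly to_std)); rewrite comp_mpoly0 linear_sum /= => s0 i.
have := congr1 (mcoeff (U_(ord0) *+ i + U_(ord_max) *+ (k - i))%MM) s0.
rewrite mcoeff0 linear_sum (bigD1 i) //= big1 ?addr0 => [|j ji].
  by rewrite linearZ /= isomon_to_std mon2E linearZ /= mcoeffX eqxx mulr1.
rewrite linearZ /= isomon_to_std mon2E linearZ /= mcoeffX.
(* The exponent of x1 recovers j. *)
case: eqP => [/mnmP/(_ ord0)|_]; last by rewrite mulr0.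
rewrite !mnmDE !mulmnE !mnm1E /= !mul1n !mul0n !addn0 => /val_inj ij.
by rewrite ij eqxx in ji.
Qed.

Lemma comp_to_stdK (p : {mpoly K[2]}) :
  p = (p \mPo to_std) \mPo [tuple u; v].
Proof.
have X1 : (x1 \mPo to_std) \mPo [tuple u; v] = x1.
  rewrite comp_mpolyXU /= comp_mpolyZ comp_mpolyD !comp_mpolyXU /=.
  rewrite /isoform scaleNr addrACA subrr addr0 -mulr2n.
  by rewrite -scaler_nat scalerA mulVf ?scale1r// pnatr_eq0.
have X2 : (x2 \mPo to_std) \mPo [tuple u; v] = x2.
  rewrite comp_mpolyXU /= comp_mpolyZ comp_mpolyB !comp_mpolyXU /=.
  rewrite /isoform scaleNr opprD addrACA subrr add0r opprK -mulr2n.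
  rewrite -scaler_nat !scalerA -mulrA mulVf ?scale1r//.
  by rewrite mulf_neq0// pnatr_eq0.
rewrite [p in LHS]mpolyE (comp_mpolyEX p to_std) linear_sum.
apply: eq_bigr => m _; rewrite /= comp_mpolyZ; congr (_ *: _).
rewrite mpolyXE_id !rmorph_prod; apply: eq_bigr => i _; rewrite !rmorphXn /=.
congr (_ ^+ _); case: i => [[|[|//]] i].
- by rewrite (_ : Ordinal i = ord0) ?X1//; exact: val_inj.
- by rewrite (_ : Ordinal i = ord_max) ?X2//; exact: val_inj.
Qed.

Lemma isoform_homog (c : K) : isoform c \is 1.-homog.
Proof.
by apply: dhomogD; [|apply: dhomogZ]; rewrite dhomogX; apply/eqP; exact: mdeg1.
Qed.

Lemma isomon_homog (k j : nat) : (j <= k)%N -> isomon e k j \is k.-homog.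
Proof.
move=> lejk; rewrite -[X in X.-homog](subnKC lejk).
have isoX (c : K) n : isoform c ^+ n \is n.-homog.
  by rewrite -[X in X.-homog]mul1n dhomogMn// isoform_homog.
by apply: dhomogM; exact: isoX.
Qed.

Lemma homog_isomonP (k : nat) (p : {mpoly K[2]}) :
  p \is k.-homog <-> exists c : 'I_k.+1 -> K, p = \sum_j c j *: isomon e k j.
Proof.
split=> [hp|[c ->]]; last first.
  apply: rpred_sum => j _; apply: dhomogZ.
  by apply: isomon_homog; rewrite -ltnS.
(* Expand p in all products u^i v^l, then keep the part of degree k. *)
rewrite -(pihomog_dE hp) [p]comp_to_stdK comp_mpolyE linear_sum /=.
elim/big_ind: _ => [|f g [a ->] [b ->]|m _].
- by exists (fun=> 0); rewrite big1// => j _; rewrite scale0r.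
- exists (fun j => a j + b j); rewrite -big_split.
  by apply: eq_bigr => j _; rewrite scalerDl.
rewrite linearZ /= !big_ord_recl big_ord0 mulr1.
rewrite (_ : lift _ _ = ord_max); last exact: val_inj.
rewrite !(tnth_nth 0) /=.
set i := m ord0; set l := m ord_max.
have il : u ^+ i * v ^+ l = isomon e (i + l) i by rewrite /isomon addKn.
have hil : u ^+ i * v ^+ l \is (i + l).-homog.
  by rewrite il isomon_homog// leq_addr.
have [ilk|ilk] := eqVneq (i + l)%N k; last first.
  rewrite (pihomog_ne0 ilk hil) scaler0; exists (fun=> 0).
  by rewrite big1// => j _; rewrite scale0r.
rewrite -ilk (pihomog_dE hil) il.
have ik : (i < (i + l).+1)%N by rewrite ltnS leq_addr.
exists (fun j => if j == Ordinal ik then (p \mPo to_std)@_m else 0).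
rewrite (bigD1 (Ordinal ik)) //= eqxx big1 ?addr0// => j /negPf ->.
by rewrite scale0r.
Qed.

(** Multiplying d1 p - e d2 p by u multiplies the coefficient of u^j v^(k-j) by
    2 j, so only the coefficient with j = 0 survives in the kernel. *)
Lemma homog_antiholomorphicP (k : nat) (p : {mpoly K[2]}) :
  p \is k.-homog /\ d1 p - e *: d2 p = 0 <-> exists c, p = c *: v ^+ k.
Proof.
split=> [[]|[c ->]]; last first.
  have vk : v ^+ k = isomon e k 0 by rewrite /isomon expr0 mul1r subn0.
  split; first by rewrite vk dhomogZ// isomon_homog.
  have Dleib f g : d1 (f * g) - e *: d2 (f * g) =
      (d1 f - e *: d2 f) * g + f * (d1 g - e *: d2 g).
    by rewrite /d1 /d2 !mderivM scalerDr -!mul_mpolyC; ring.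
  have Dv : d1 v - e *: d2 v = 0 *: v.
    by rewrite d1_isoform d2_isoform -mul_mpolyC -mpolyCM mulrN e_sq
       opprK mpolyC1 subrr scale0r.
  have := leibniz_eigen_monomial (fun f => d1 f - e *: d2 f) _ _ _ _ 0 k
    Dleib Dv Dv.
  rewrite !mul0r addr0 scale0r expr0 mul1r /d1 /d2 !mderivZ.
  by rewrite scalerA mulrC -scalerA -scalerBr => ->; rewrite scaler0.
move=> /homog_isomonP[c ->].
set p' := \sum_j _ => Ep'.
have E0 : \sum_(j < k.+1) (c j * (2 * j%:R)) *: isomon e k j = 0.
  have eulerD : {morph euler_u : f g / f + g}.
    by move=> f g; rewrite /euler_u /d1 /d2 !mderivD scalerDr; ring.
  have euler0 : euler_u 0 = 0.
    by rewrite /euler_u /d1 /d2 !mderiv0 scaler0 subr0 mulr0.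
  transitivity (euler_u p'); last by rewrite /euler_u Ep' mulr0.
  rewrite /p' (big_morph euler_u eulerD euler0).
  apply: eq_bigr => j _.
  rewrite -scalerA -euler_u_isomon /euler_u /d1 /d2 !mderivZ.
  by rewrite scalerAr scalerBr !scalerA [c j * e]mulrC.
have c0 (j : 'I_k.+1) : j != ord0 -> c j = 0.
  move=> j0; have /eqP := isomon_free k _ E0 j.
  have jn0 : (j == 0 :> nat) = false := negPf j0.
  by rewrite !mulf_eq0 !pnatr_eq0 jn0 !orbF => /eqP.
exists (c ord0); rewrite /p' big_ord_recl big1 ?addr0 => [|j _].
  by rewrite /isomon expr0 mul1r subn0.
by rewrite c0 ?scale0r.
Qed.
End ScalarPolynomials.
Arguments rotation {K}.

(** * Polynomials with values in a spinor line *)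

Section SpinorPolynomials.
Variable R : realType.
Implicit Types (s t : cl2 R[i]) (p q : {mpoly R[i][2]}) (P Q : clpoly R).

Definition spin s p : clpoly R := scalar_poly p * s%:MP.

Lemma mcoeff_spin s p m : (spin s p)@_m = p@_m *: s.
Proof.
rewrite /spin {1}[p]mpolyE /scalar_poly raddf_sum mulr_suml raddf_sum /=.
rewrite [p in RHS]mpolyE (raddf_sum (mcoeff m)) scaler_suml.
apply: eq_bigr => l _; rewrite /= map_mpolyZ map_mpolyX -scalerAl -commr_mpolyX.
rewrite !mcoeffZ mcoeffCM !mcoeffX /=.
by case: eqP => _; rewrite ?mulr1 ?mulr0 ?mulr_algl ?scale0r.
Qed.

Lemma spin0 s : spin s 0 = 0.
Proof. by apply/mpolyP => m; rewrite mcoeff_spin !mcoeff0 scale0r. Qed.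

Lemma spinD s : {morph spin s : p q / p + q}.
Proof. by move=> p q; rewrite /spin /scalar_poly raddfD /= mulrDl. Qed.

Lemma spinB s : {morph spin s : p q / p - q}.
Proof. by move=> p q; rewrite /spin /scalar_poly raddfB /= mulrBl. Qed.

Lemma spinZ s (c : R[i]) p : spin s (c *: p) = c%:A *: spin s p.
Proof.
by rewrite /spin /scalar_poly map_mpolyZ scalerAl.
Qed.

Lemma scalar_polyM p q : scalar_poly (p * q) = scalar_poly p * scalar_poly q.
Proof. exact: rmorphM. Qed.

Lemma scalar_poly_spin s q p : scalar_poly q * spin s p = spin s (q * p).
Proof. by rewrite /spin scalar_polyM mulrA. Qed.

(** Complex scalars are central, so one in front of s can be moved to the scalar
    polynomial; this brings everything back to a fixed s. *)
Lemma spinZl s (c : R[i]) p : spin (c *: s) p = spin s (c *: p).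
Proof.
have cE : (c *: s)%:MP = scalar_poly c%:MP_[2] * s%:MP.
  by rewrite /scalar_poly map_mpolyC -mpolyCM /= mulr_algl.
transitivity (scalar_poly p * scalar_poly c%:MP * s%:MP).
  by rewrite /spin cE; exact: mulrA.
congr (_ * s%:MP); transitivity (scalar_poly (p * c%:MP)).
  exact/esym/scalar_polyM.
by congr scalar_poly; rewrite mulrC mul_mpolyC.
Qed.

Lemma mul_spin s t p : t%:MP * spin s p = spin (t * s) p.
Proof.
apply/mpolyP => m; transitivity (t * (p@_m *: s)).
  by rewrite mcoeffCM mcoeff_spin.
by rewrite -scalerAr -mcoeff_spin.
Qed.

Lemma mpolyX_spin s (i : 'I_2) p : 'X_i * spin s p = spin s ('X_i * p).
Proof. by rewrite -scalar_poly_spin /scalar_poly map_mpolyX. Qed.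

Lemma mderiv_spin s (i : 'I_2) p : (spin s p)^`M(i) = spin s p^`M(i).
Proof.
by apply/mpolyP => m; rewrite mcoeff_deriv 2!mcoeff_spin mcoeff_deriv scalerMnl.
Qed.

Lemma spin_eq0 s p : s != 0 -> spin s p = 0 -> p = 0.
Proof.
move=> s0 /mpolyP sp0; apply/mpolyP => m; rewrite mcoeff0.
have /eqP := sp0 m; rewrite mcoeff_spin mcoeff0 scaler_eq0 (negPf s0) orbF.
by move=> /eqP.
Qed.

Lemma cspan_spinP s p Q :
  cspan (spin s p) Q <-> exists c : R[i], Q = spin s (c *: p).
Proof. by split=> [[c _ <-]|[c ->]]; exists c; rewrite ?spinZ. Qed.

(** A polynomial with coefficients on the line of s is p s for a unique p, whose
    coefficients are chosen one by one on the finite support. *)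
Lemma homog_poly_line (k : nat) s : s != 0 ->
  homog_poly k [set a *: s | a in [set: R[i]]] =
  [set spin s p | p in [set p | p \is k.-homog]].
Proof.
move=> s0; apply/seteqP.
split=> [P [/dhomogP hP coefP]|_ [p /dhomogP hp <-]]; last first.
  split; last by move=> m; rewrite mcoeff_spin; exists (p@_m).
  apply/dhomogP => m; rewrite mcoeff_msupp mcoeff_spin => pm0.
  apply: hp; rewrite mcoeff_msupp.
  by apply: contraNneq pm0 => ->; rewrite scale0r.
have /boolp.choice[a aP] : forall m, exists b, P@_m = b *: s.
  by move=> m; have [b _ <-] := coefP m; exists b.
pose p := \sum_(m <- msupp P) a m *: 'X_[m] : {mpoly R[i][2]}.
have pE m : p@_m = if m \in msupp P then a m else 0.
  rewrite /p raddf_sum /=; under eq_bigr do rewrite mcoeffZ mcoeffX.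
  case: ifPn => mP.
    rewrite (bigD1_seq m)//= eqxx mulr1 big1 ?addr0// => l /negPf ->.
    by rewrite mulr0.
  rewrite big_seq big1// => l lP; case: eqP => [lm|]; rewrite ?mulr0//.
  by rewrite -lm lP in mP.
exists p => /=.
  apply/dhomogP => m; rewrite mcoeff_msupp pE.
  by case: ifPn => [mP _|_]; [exact: hP|rewrite eqxx].
apply/mpolyP => m; rewrite mcoeff_spin pE; case: ifPn => mP //.
by rewrite scale0r memN_msupp_eq0.
Qed.

(** * Lines as so(2)-modules *)

Lemma algA_scale (a b : R[i]) P : a%:A *: (b%:A *: P) = (a * b)%:A *: P.
Proof. by rewrite scalerA mulr_algl scalerA. Qed.

Lemma cspan_subspace P : subspace (cspan P).
Proof.
split; first by exists 0 => //; rewrite !scale0r.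
move=> c _ _ [a _ <-] [b _ <-]; exists (c * a + b) => //.
by rewrite !scalerDl algA_scale.
Qed.

Lemma line_irreducible P (mu : R[i]) : P <> 0 ->
    (forall Q, cspan P Q -> L12 Q = mu%:A *: Q) ->
  so2_irreducible (cspan P).
Proof.
move=> P0 L12P; have PP : cspan P P by exists 1 => //; rewrite !scale1r.
split; [|by exists P|].
  split; first exact: cspan_subspace.
  move=> X Q _ PQ; rewrite /so2_act L12P//; case: PQ => c _ <-.
  exists (2 * cl12 X * (mu * c)) => [//|].
  by rewrite -algA_scale -[(mu * c)%:A *: P]algA_scale.
move=> U [[U0 Ulin] _] UP.
have [[Q UQ Q0]|noQ] := pselect (exists2 Q, U Q & Q <> 0); [right|left].
  apply/seteqP; split=> // _ [d _ <-]; have [c _ cP] := UP _ UQ.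
  have c0 : c != 0 by apply/eqP => c0; apply: Q0; rewrite -cP c0 !scale0r.
  have := Ulin (d / c) _ _ UQ U0.
  by rewrite addr0 -cP algA_scale divfK.
apply/seteqP; split=> [Q UQ /=|_ ->//].
by apply/eqP; apply: contra_notT noQ => /eqP Q0; exists Q.
Qed.

Lemma line_highest_weight P (mu : R[i]) : P <> 0 ->
    (forall Q, cspan P Q -> L12 Q = mu%:A *: Q) ->
  has_highest_weight (cspan P) (- 'i * mu).
Proof.
move=> P0 L12P; split; first by exists P.
by move=> Q PQ; rewrite /H (L12P _ PQ); exact: algA_scale.
Qed.

(** * The decomposition for one chirality *)

Section ChiralLine.
Variables (e : R[i]) (s : cl2 R[i]).
Hypotheses (e_sq : e * e = -1) (s_neq0 : s != 0) (e12s : e12 * s = e *: s).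

Local Notation u := (isoform e).
Local Notation v := (isoform (- e)).
Local Notation line := [set a *: s | a in [set: R[i]]].

(** On the line of s the two generators differ by a scalar, which turns the Dirac
    operator into a scalar first-order operator. *)
Lemma mul_e2s : e2 * s = - e *: (e1 * s).
Proof.
by rewrite scaleNr scalerAr -e12s /e12 !mulrA e1_sq mulN1r mulNr opprK.
Qed.

Lemma mul_e1s_neq0 : e1 * s != 0.
Proof.
have sE : s = - (e1 * (e1 * s)) by rewrite mulrA e1_sq mulN1r opprK.
by apply: contraNneq s_neq0 => e1s0; rewrite sE e1s0 mulr0 oppr0.
Qed.

Lemma dirac_spin p : dirac (spin s p) = spin (e1 * s) (d1 p - e *: d2 p).
Proof.
rewrite /dirac /d1 /d2 !mderiv_spin !mul_spin mul_e2s spinZl -spinD.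
by rewrite scaleNr.
Qed.

Lemma L12_spin p : L12 (spin s p) = spin s ((e / 2) *: p + rotation p).
Proof.
rewrite /L12 /rotation /d1 /d2 !mderiv_spin mul_spin !mpolyX_spin.
by rewrite -scalerAl e12s scalerA mulrC spinZl -spinD -spinB addrA.
Qed.

Lemma L12_isomon (k j : nat) Q : (j <= k)%N ->
    cspan (spin s (isomon e k j)) Q ->
  L12 Q = (e * (k%:R + 2^-1 - 2 * j%:R))%:A *: Q.
Proof.
move=> lejk /cspan_spinP[c ->]; rewrite L12_spin -spinZ.
congr (spin s _).
have -> f : rotation (c *: f) = c *: rotation f.
  by rewrite /rotation /d1 /d2 !mderivZ -!scalerAr scalerBr.
rewrite (rotation_isomon _ _ e_sq _ _ lejk) !scalerA -scalerDl.
congr (_ *: _); ring.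
Qed.

Lemma monogenic_line (j : nat) : monogenic j line = cspan (spin s (v ^+ j)).
Proof.
rewrite /monogenic homog_poly_line//.
have dirac0 p : dirac (spin s p) = 0 <-> d1 p - e *: d2 p = 0.
  rewrite dirac_spin; split=> [/(spin_eq0 _ _ mul_e1s_neq0)//|->].
  exact: spin0.
apply/seteqP; split=> [_ [[p hp <-] /dirac0 Dp]|_ /cspan_spinP[c ->]].
  have [c ->] := (homog_antiholomorphicP _ _ e_sq j p).1 (conj hp Dp).
  by apply/cspan_spinP; exists c.
have [hp Dp] := (homog_antiholomorphicP _ _ e_sq j _).2 (ex_intro _ c erefl).
by split; [exists (c *: v ^+ j)|apply/dirac0].
Qed.

Lemma pmul_monogenic_line (k j : nat) :
  pmul (u ^+ j) (monogenic (k - j) line) = cspan (spin s (isomon e k j)).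
Proof.
rewrite monogenic_line /pmul.
have mulE c : u ^+ j * (c *: v ^+ (k - j)) = c *: isomon e k j.
  by rewrite -scalerAr.
apply/seteqP; split=> [_ [_ /cspan_spinP[c ->] <-]|_ /cspan_spinP[c ->]].
  by apply/cspan_spinP; exists c; rewrite scalar_poly_spin mulE.
exists (spin s (c *: v ^+ (k - j))); first by apply/cspan_spinP; exists c.
by rewrite scalar_poly_spin mulE.
Qed.

Lemma direct_sum_isomon (k : nat) :
  direct_sum (fun j : 'I_k.+1 => cspan (spin s (isomon e k j)))
    (homog_poly k line).
Proof.
have coeffs (f : 'I_k.+1 -> clpoly R) :
    (forall j : 'I_k.+1, cspan (spin s (isomon e k j)) (f j)) ->
    exists c : 'I_k.+1 -> R[i], f = fun j => spin s (c j *: isomon e k j).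
  move=> fP; have /boolp.choice[c cf] : forall j : 'I_k.+1, exists c,
      f j = spin s (c *: isomon e k j).
    by move=> j; apply/cspan_spinP; exact: fP.
  by exists c; apply/funext.
have spin_sum (c : 'I_k.+1 -> R[i]) :
    \sum_j spin s (c j *: isomon e k j) =
    spin s (\sum_j c j *: isomon e k j).
  by rewrite (big_morph (spin s) (spinD s) (spin0 s)).
split=> [j||f /coeffs[c ->]]; first exact: cspan_subspace.
  rewrite homog_poly_line//; apply/seteqP; split=> [_ [p hp <-]|_ [f fP <-]].
    have [c ->] := (homog_isomonP _ _ e_sq k p).1 hp.
    exists (fun j => spin s (c j *: isomon e k j)); last exact: spin_sum.
    by move=> j; apply/cspan_spinP; exists (c j).
  have [c ->] := coeffs _ fP; rewrite spin_sum.
  exists (\sum_j c j *: isomon e k j) => //.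
  by apply/(homog_isomonP _ _ e_sq); exists c.
rewrite spin_sum => /(spin_eq0 _ _ s_neq0)/(isomon_free _ _ e_sq) c0 j.
by rewrite c0 scale0r spin0.
Qed.

(** The Fischer decomposition for one chirality: with e = i and s = I1 the lines
    are z^j M^+_(k-j), with e = -i and s = w1 I1 they are zbar^j M^-_(k-j). *)
Lemma fischer_line (k : nat) :
  [/\ forall j : 'I_k.+1, monogenic j line = cspan (spin s (v ^+ j)),
      direct_sum (fun j : 'I_k.+1 => pmul (u ^+ j) (monogenic (k - j) line))
        (homog_poly k line) &
      forall j : 'I_k.+1,
        so2_irreducible (pmul (u ^+ j) (monogenic (k - j) line)) /\
        has_highest_weight (pmul (u ^+ j) (monogenic (k - j) line))
          (- 'i * (e * (k%:R + 2^-1 - 2 * j%:R)))].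
Proof.
split=> [j||j]; first exact: monogenic_line.
  under eq_fun do rewrite pmul_monogenic_line.
  exact: direct_sum_isomon.
have lejk : (j <= k)%N by rewrite -ltnS.
have P0 : spin s (isomon e k j) <> 0.
  move=> /(spin_eq0 _ _ s_neq0) m0.
  have /(isomon_free _ _ e_sq)/(_ j)/eqP :
      \sum_(l < k.+1) (l == j)%:R *: isomon e k l = 0.
    rewrite (bigD1 j)//= m0 scaler0 add0r big1// => l /negPf ->.
    by rewrite scale0r.
  by rewrite eqxx oner_eq0.
by rewrite pmul_monogenic_line; split; [apply: line_irreducible|
  apply: line_highest_weight] => // Q; exact: L12_isomon.
Qed.
End ChiralLine.

(** * The two spinor lines *)

Lemma imaginary_sq : 'i * 'i = -1 :> R[i].
Proof. by rewrite -expr2 sqrCi. Qed.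

Lemma e12_I1 : e12 * I1 R = 'i *: I1 R.
Proof. by congr Cl2; rewrite /=; ring: imaginary_sq. Qed.

Lemma e12_w1I1 : e12 * (w1 R * I1 R) = - 'i *: (w1 R * I1 R).
Proof.
have -> : e12 * (w1 R * I1 R) = (e12 * w1 R) * I1 R by rewrite mulrA.
have -> : e12 * w1 R = - 'i *: w1 R.
  by congr Cl2; rewrite /=; ring: imaginary_sq.
by rewrite -scalerAl.
Qed.

Lemma I1_neq0 : I1 R != 0.
Proof.
have E : cl0 (I1 R) = 2^-1 by rewrite /=; ring.
by apply/eqP => I0; move/eqP: E; rewrite I0 eq_sym invr_eq0 pnatr_eq0.
Qed.

Lemma w1I1_neq0 : w1 R * I1 R != 0.
Proof.
have E : cl1 (w1 R * I1 R) = 2^-1 by rewrite /=; field: imaginary_sq.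
by apply/eqP => w0; move/eqP: E; rewrite w0 eq_sym invr_eq0 pnatr_eq0.
Qed.
End SpinorPolynomials.

(** * Assembling the two chiralities *)

Theorem theorem3 (R : realType) (k : nat) :
  [/\ forall j : 'I_k.+1,
        monogenic j (Splus R) = cspan (spinor_poly (zbar R ^+ j) 0) /\
        monogenic j (Sminus R) = cspan (spinor_poly 0 (z R ^+ j)),
      direct_sum
        (fun j : 'I_k.+1 => pmul (z R ^+ j) (monogenic (k - j) (Splus R)))
        (homog_poly k (Splus R)),
      direct_sum
        (fun j : 'I_k.+1 => pmul (zbar R ^+ j) (monogenic (k - j) (Sminus R)))
        (homog_poly k (Sminus R)) &
      forall j : 'I_k.+1,
        [/\ so2_irreducible (pmul (z R ^+ j) (monogenic (k - j) (Splus R))),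
            has_highest_weight (pmul (z R ^+ j) (monogenic (k - j) (Splus R)))
              (k%:R + 2^-1 - 2 * j%:R),
            so2_irreducible
              (pmul (zbar R ^+ j) (monogenic (k - j) (Sminus R))) &
            has_highest_weight
              (pmul (zbar R ^+ j) (monogenic (k - j) (Sminus R)))
              (- k%:R - 2^-1 + 2 * j%:R)]].
Proof.
have ii := imaginary_sq R.
have nii : - 'i * - 'i = -1 :> R[i] by rewrite mulrNN.
have zbarE : isoform (- 'i) = zbar R by rewrite /isoform scaleNr.
have spinp p : spin R (I1 R) p = spinor_poly p 0.
  by rewrite /spinor_poly [scalar_poly 0]raddf0 mul0r addr0.
have spinm p : spin R (w1 R * I1 R) p = spinor_poly 0 p.
  by rewrite /spinor_poly [scalar_poly 0]raddf0 mul0r add0r.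
have [Mp Dp Wp] := fischer_line R _ _ ii (I1_neq0 R) (e12_I1 R) k.
have [Mm Dm Wm] := fischer_line R _ _ nii (w1I1_neq0 R) (e12_w1I1 R) k.
(* For e = -i the form v is isoform (- - i), which is z by definition. *)
rewrite opprK in Mm; rewrite zbarE in Mp Dm Wm.
split=> [j|||j].
- by rewrite -spinp -spinm; split; [exact: Mp|exact: Mm].
- exact: Dp.
- exact: Dm.
have [Ip Hp] := Wp j; have [Im Hm] := Wm j.
split; [exact: Ip|have -> : k%:R + 2^-1 - 2 * j%:R =
   - 'i * ('i * (k%:R + 2^-1 - 2 * j%:R)) :> R[i] by ring: ii
   | exact: Im|have -> : - k%:R - 2^-1 + 2 * j%:R =
   - 'i * (- 'i * (k%:R + 2^-1 - 2 * j%:R)) :> R[i] by ring: ii].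
- exact: Hp.
- exact: Hm.
Qed.
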